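(* Let $n$ be a natural number and let $\Vdash_n$ be either $\models_n$ or $\models^\alpha_n$. Then intuitionistic propositional logic $\mathrm{IL}$ is not base-complete over $\Vdash_n$; that is, it is not the case that for all $\mathfrak{B}\in\mathbb{B}^n$, all finite sets of formulas $\Gamma$ and all formulas $A$, $\Gamma\Vdash_{\mathfrak{B},n}A$ implies $\Gamma\vdash_{\mathrm{IL}\cup\mathfrak{B}}A$.
   Context: LANGUAGE. $\mathscr{L}$ is the propositional language whose formulas are built from infinitely many propositional letters and the atomic constant $\bot$ by $\wedge,\vee,\rightarrow$; $\neg X := X \rightarrow \bot$. $\mathrm{ATOM}$ is the set of the letters together with $\bot$. $\Gamma,\Delta$ always range over finite sets of formulas. ATOMIC RULES. A rule of level $0$ is an atom (an axiom). A rule of level $1$ infers an atom $A$ from atoms $A_1,\dots,A_m$. For $k\ge 1$, if $\Re_1,\dots,\Re_m$ are finite sets of atomic rules (some possibly empty) of maximal level $k-1$, then $([\Re_1]A_1,\dots,[\Re_m]A_m)/A$, which infers the atom $A$ from the atoms $A_1,\dots,A_m$ and discharges the rules in $\Re_i$ in the derivation of the $i$-th premise, is a rule of level $k+1$. ATOMIC BASES. An atomic base is a (possibly infinite) set $\mathfrak{B}$ of atomic rules containing the explosion rule $\bot/A$ for every atom $A$; its level is the maximal level of its rules other than the explosion rules ($0$ if there are none). $\mathbb{B}^n$ is the set of bases of level $\le n$. $\mathfrak{C}\supseteq_n\mathfrak{B}$ means $\mathfrak{C}\supseteq\mathfrak{B}$ and $\mathfrak{C}\in\mathbb{B}^n$.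 Derivations in $\mathfrak{B}$ are defined inductively: an atom $A$ is a single-node derivation of $A$, from no assumed rules if the axiom $A\in\mathfrak{B}$ is applied, and from the assumed rule $A$ if $A$ is assumed; if $\mathscr{D}_i$ derives $A_i$ from assumed rules $\mathfrak{C}_i\cup\Re_i$ ($i\le m$), then applying $R=([\Re_1]A_1,\dots,[\Re_m]A_m)/A$ yields a derivation of $A$ from $\bigcup_i\mathfrak{C}_i$ if $R\in\mathfrak{B}$, and from $\bigcup_i\mathfrak{C}_i\cup\{R\}$ if $R\notin\mathfrak{B}$. $\vdash_{\mathfrak{B}}A$ means that there is a derivation of $A$ in $\mathfrak{B}$ from no assumed rules (a closed derivation). STANDARD BASE SEMANTICS. For $\mathfrak{B}\in\mathbb{B}^n$, define: for $A\in\mathrm{ATOM}$, $\models_{\mathfrak{B},n}A$ iff $\vdash_{\mathfrak{B}}A$; $\models_{\mathfrak{B},n}B\wedge C$ iff $\models_{\mathfrak{B},n}B$ and $\models_{\mathfrak{B},n}C$; $\models_{\mathfrak{B},n}B\vee C$ iff $\models_{\mathfrak{B},n}B$ or $\models_{\mathfrak{B},n}C$; $\models_{\mathfrak{B},n}B\rightarrow C$ iff $B\models_{\mathfrak{B},n}C$; for $\Gamma\ne\emptyset$, $\Gamma\models_{\mathfrak{B},n}A$ iff for all $\mathfrak{C}\supseteq_n\mathfrak{B}$, if $\models_{\mathfrak{C},n}B$ for all $B\in\Gamma$ then $\models_{\mathfrak{C},n}A$. REDUCIBILITY SEMANTICS. An argument structure $\mathscr{D}=\langle T,\langle f,h,g\rangle\rangle$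 consists of a finite rooted tree $T$ with nodes labelled by formulas ($\mu\prec\nu$ means that $\nu$ lies below $\mu$, towards the root), whose leaves are partitioned into assumption leaves $\mathrm{as}(T)$ and axiom leaves $\mathrm{ax}(T)$, and of partial discharge functions: $f$ is defined on a subset of $\mathrm{as}(T)$ with $\mu\prec f(\mu)$; $h$ is defined on a subset of $\mathrm{ax}(T)$ with $\mu\prec h(\mu)$, where $h(\mu)$ and its children are labelled by atoms and $h(\mu)$ is not a value of $f$; $g$ is defined on a set of sets $K$ of edges, each $K$ consisting of all and only the edges linking a node $\mu_K$ to its children, where $\mu_K$ and its children are labelled by atoms, $\mu_K$ is not a value of $f$, $\mu_K\prec g(K)$, $g(K)$ and its children are labelled by atoms, and $g(K)$ is not a value of $f$. ($f$ discharges assumptions; $h$ and $g$ discharge assumed atomic rules of level $0$ and higher.) The root label is the conclusion. $\mathscr{D}$ is from $\Gamma$ to $A$ if $\Gamma$ is the set of its undischarged assumptions and $A$ its conclusion; it is closed if $\Gamma=\emptyset$, open otherwise. Derivations in $\mathfrak{B}$ are regarded as argument structures with all labels atomic and $f$ empty. $\mathscr{D}[\mathscr{D}^{**}/\mathscr{D}^*]$ is the result of replacing the sub-structure $\mathscr{D}^*$ by $\mathscr{D}^{**}$ in $\mathscr{D}$, the discharge functions being redefined in the natural way (discharges of surviving or copied assumptions and assumed rules take place at the corresponding nodes; the others disappear). If $\mathscr{D}$ is from $\Gamma=\{\mu_1,\dots,\mu_m\}$ and $\sigma$ assigns to each $\mu_i$ an argument structure $\sigma(\mu_i)$ with the same conclusion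 as $\mu_i$, then $\mathscr{D}^\sigma=\mathscr{D}[\sigma(\mu_1),\dots,\sigma(\mu_m)/\mu_1,\dots,\mu_m]$; it is a closed $\sigma$-instance if all $\sigma(\mu_i)$ are closed. An inference is a triple $\langle\langle\mathscr{D}_1,\dots,\mathscr{D}_m\rangle,A,\delta\rangle$ with $\delta$ an extension of the discharge functions of the $\mathscr{D}_i$; its associated argument structure joins the trees of the $\mathscr{D}_i$ by a new root $A$ and adds the discharges $\delta$. A rule is a (recursive) set of inferences, its instances. Introduction rules are Gentzen's: $A,B/A\wedge B$; $A_i/A_1\vee A_2$ ($i=1,2$); $[A]B/A\rightarrow B$. $\mathscr{D}$ is canonical if it is associated to an instance of an introduction rule. A reduction for a rule $R$ is a map $\phi$ from and to argument structures, defined on some set $\mathbb{D}$ of argument structures associated to instances of $R$, such that for all $\mathscr{D}\in\mathbb{D}$: (a) if $\mathscr{D}$ is from $\Gamma$ to $A$, then $\phi(\mathscr{D})$ is from some $\Gamma^*\subseteq\Gamma$ to $A$; (b) for all $\sigma$, $\phi$ is defined on $\mathscr{D}^\sigma$ and $\phi(\mathscr{D}^\sigma)=\phi(\mathscr{D})^\sigma$. For a set $\mathfrak{J}$ of reductions, $\mathscr{D}\leq_{\mathfrak{J}}\mathscr{D}^*$ is the reflexive-transitive closure of: $\mathscr{D}^*=\mathscr{D}[\phi(\mathscr{D}^{**})/\mathscr{D}^{**}]$ for some sub-structure $\mathscr{D}^{**}$ of $\mathscr{D}$ and some $\phi\in\mathfrak{J}$. An argument is a pair $\langle\mathscr{D},\mathfrak{J}\rangle$.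 It is $n$-valid on $\mathfrak{B}\in\mathbb{B}^n$ iff: when $\mathscr{D}$ is closed with atomic conclusion, $\mathscr{D}\leq_{\mathfrak{J}}\mathscr{D}^*$ for some closed derivation $\mathscr{D}^*$ in $\mathfrak{B}$; when $\mathscr{D}$ is closed with non-atomic conclusion, $\mathscr{D}\leq_{\mathfrak{J}}\mathscr{D}^*$ for some canonical $\mathscr{D}^*$ whose immediate sub-structures, paired with $\mathfrak{J}$, are $n$-valid on $\mathfrak{B}$; when $\mathscr{D}$ is open with undischarged assumptions $\Gamma$, for all $\sigma$ assigning closed structures, all sets of reductions $\mathfrak{J}^+\supseteq\mathfrak{J}$ and all $\mathfrak{C}\supseteq_n\mathfrak{B}$, if $\langle\sigma(\mu),\mathfrak{J}^+\rangle$ is $n$-valid on $\mathfrak{C}$ for all $\mu\in\Gamma$, then $\langle\mathscr{D}^\sigma,\mathfrak{J}^+\rangle$ is $n$-valid on $\mathfrak{C}$. $\Gamma\models^\alpha_{\mathfrak{B},n}A$ means that some argument $\langle\mathscr{D},\mathfrak{J}\rangle$ with $\mathscr{D}$ from $\Gamma$ to $A$ is $n$-valid on $\mathfrak{B}$. IL OVER BASES. Extended derivations are built inductively from single formulas (assumed, or, for atoms, possibly used as axioms) by the natural deduction rules of $\mathrm{IL}$ in the standard way and by applications of arbitrary atomic rules $([\Re_1]A_1,\dots,[\Re_m]A_m)/B$, which discharge the rules $\Re_i$ used in the derivation of the $i$-th premise. $\Gamma\vdash_{\mathrm{IL}\cup\mathfrak{B}}A$ means that there is an extended derivation from $\Gamma$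 to $A$ whose only additional (undischarged) atomic rules are those in $\mathfrak{B}$. *)

(* Defs.v *)
From HB Require Import structures.
From Stdlib Require Import List Relations.
From mathcomp Require Import all_boot.

Set Implicit Arguments.
Unset Strict Implicit.
Unset Printing Implicit Defensive.

Inductive atom := Letter of nat | Bot.

Inductive formula :=
  | Atom of atom
  | And of formula & formula
  | Or of formula & formula
  | Imp of formula & formula.

Definition atom_eq_dec (a b : atom) : {a = b} + {a <> b}.
Proof. by decide equality; apply: eq_comparable. Defined.
HB.instance Definition _ := hasDecEq.Build atom (compareP atom_eq_dec).

Definition formula_eq_dec (A B : formula) : {A = B} + {A <> B}.
Proof. by decide equality; apply: eq_comparable. Defined.
HB.instance Definition _ := hasDecEq.Build formula (compareP formula_eq_dec).

Definition atomic (A : formula) : bool := if A is Atom _ then true else false.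

(* [Rule [:: (Rs1, A1); ...; (Rsm, Am)] A] is ([Rs1]A1, ..., [Rsm]Am)/A; the
   sequences Rsi stand for finite sets.  With no premises it is the axiom A. *)
Inductive rule := Rule of seq (seq rule * atom) & atom.

(* Level 1 as soon as there is a premise, and at least [level r + 2] for every
   discharged rule r: if k - 1 is the maximal level of the discharged rules,
   the level is k + 1. *)
Fixpoint level (R : rule) : nat :=
  let: Rule ps _ := R in
  if ps is [::] then 0 else
  foldr (fun p m => maxn (foldr (fun r m' => maxn (level r).+2 m') 0 p.1) m)
        1 ps.

Definition explosion (a : atom) : rule := Rule [:: ([::], Bot)] a.

Definition base := rule -> Prop.

(* The explosion rules, which have level 1, do not count for the level of a
   base. *)
Definition base_le (n : nat) (B : base) : Prop :=
  (forall a, B (explosion a)) /\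
  (forall R, B R -> level R <= n \/ exists a, R = explosion a).

Definition base_ext (n : nat) (B C : base) : Prop :=
  (forall R, B R -> C R) /\ base_le n C.

(* A discharge function sends a node to a node strictly below it, so its value
   is given by the distance along the branch: [Some k] is the k-th node below,
   [Some 0] being the immediate successor towards the root; [None] means that
   the function is undefined.  The pointer of an assumption leaf [Asm] is the
   value of f, that of an axiom leaf [Ax] the value of h, and that of [Node] the
   value of g on the set of edges linking the node to its children. *)
Inductive tree :=
  | Asm of formula & option nat
  | Ax of formula & option nat
  | Node of formula & option nat & seq tree.

Definition concl (t : tree) : formula :=
  match t with Asm A _ => A | Ax A _ => A | Node A _ _ => A end.

(* The labels of the assumption leaves which f sends to the d-th node below the
   root of t. *)
Fixpoint discharged (d : nat) (t : tree) : seq formula :=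
  match t with
  | Asm A p => if p == Some d then [:: A] else [::]
  | Ax _ _ => [::]
  | Node _ _ ts => flatten (map (discharged d.+1) ts)
  end.

(* The condition on the values of h and g, and also on the nodes where g may be
   defined. *)
Definition atomic_node (A : formula) (ts : seq tree) : bool :=
  [&& atomic A, all (fun t => atomic (concl t)) ts
    & nilp (flatten (map (discharged 0) ts))].

(* [env] has one entry for each node below t, telling whether it may be a value
   of h or g. *)
Fixpoint wf_under (env : seq bool) (t : tree) : bool :=
  match t with
  | Asm _ p => if p is Some k then k < size env else true
  | Ax A p => if p is Some k then atomic A && nth false env k else true
  | Node A p ts =>
      [&& ~~ nilp ts,
          (if p is Some k then atomic_node A ts && nth false env k else true)
        & all (wf_under (atomic_node A ts :: env)) ts]
  end.

Definition structure (t : tree) : bool := wf_under [::] t.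

(* The undischarged assumptions, identified by their labels. *)
Fixpoint assumptions (t : tree) : seq formula :=
  match t with
  | Asm A p => if p is None then [:: A] else [::]
  | Ax _ _ => [::]
  | Node _ _ ts => flatten (map assumptions ts)
  end.

Definition closed_tree (t : tree) : bool := nilp (assumptions t).

(* [cut 0] turns the subtree rooted at a node into the sub-structure rooted
   there: the discharges taking place below that node are dropped. *)
Definition cut_ptr (d : nat) (p : option nat) : option nat :=
  if p is Some k then if k < d then p else None else None.

Fixpoint cut (d : nat) (t : tree) : tree :=
  match t with
  | Asm A p => Asm A (cut_ptr d p)
  | Ax A p => Ax A (cut_ptr d p)
  | Node A p ts => Node A (cut_ptr d p) (map (cut d.+1) ts)
  end.

Definition immediate (t : tree) : seq tree :=
  if t is Node _ _ ts then map (cut 0) ts else [::].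

(* Pointers being relative, neither D nor the substituted structures need any
   adjustment. *)
Fixpoint subst (s : formula -> tree) (t : tree) : tree :=
  match t with
  | Asm A None => s A
  | Asm _ _ | Ax _ _ => t
  | Node A p ts => Node A p (map (subst s) ts)
  end.

Definition assignment (s : formula -> tree) (t : tree) : Prop :=
  forall A, A \in assumptions t -> structure (s A) /\ concl (s A) = A.

Definition closed_assignment (s : formula -> tree) (t : tree) : Prop :=
  assignment s t /\ forall A, A \in assumptions t -> closed_tree (s A).

(* [env] lists the sets of rules which the nodes below discharge in the premise
   at hand.  A node applies a rule of the base, or a rule discharged at the node
   it points to. *)
Definition available (B : base) (env : seq (seq rule)) (R : rule)
    (p : option nat) : Prop :=
  if p is Some k then List.In R (nth [::] env k) else B R.

Inductive derivation (B : base) : seq (seq rule) -> tree -> Prop :=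
  | der_axiom env a p :
      available B env (Rule [::] a) p -> derivation B env (Ax (Atom a) p)
  | der_rule env ps a p ts :
      ps <> [::] ->
      available B env (Rule ps a) p ->
      map concl ts = map (fun q => Atom q.2) ps ->
      (forall q t, List.In (q, t) (zip ps ts) -> derivation B (q.1 :: env) t) ->
      derivation B env (Node (Atom a) p ts).

Definition closed_derivation (B : base) (t : tree) : Prop :=
  derivation B [::] t.

Definition derivable (B : base) (a : atom) : Prop :=
  exists2 t, closed_derivation B t & concl t = Atom a.

Fixpoint sat (n : nat) (A : formula) (B : base) : Prop :=
  match A with
  | Atom a => derivable B a
  | And A1 A2 => sat n A1 B /\ sat n A2 B
  | Or A1 A2 => sat n A1 B \/ sat n A2 B
  | Imp A1 A2 => forall C, base_ext n B C -> sat n A1 C -> sat n A2 C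
  end.

Definition standard_consequence (n : nat) (B : base) (G : seq formula)
    (A : formula) : Prop :=
  if G is [::] then sat n A B else
  forall C, base_ext n B C -> (forall F, F \in G -> sat n F C) -> sat n A C.

(* An inference is determined by its associated structure: its premises are the
   immediate sub-structures, its conclusion the root label, and the discharges
   it adds those taking place at the root (an axiom leaf being an inference
   without premises).  So a rule is given as the set of the structures
   associated to its instances.  Recursiveness is not imposed: the set of all
   inferences is recursive, so a reduction for an arbitrary set of inferences is
   also a reduction for a recursive one. *)
Definition is_inference (t : tree) : bool :=
  structure t && (if t is Asm _ _ then false else true).

Definition inference_rule (R : tree -> Prop) : Prop :=
  forall t, R t -> is_inference t.

Definition canonical (t : tree) : bool :=
  structure t &&
  match t with
  | Node (And A B) _ [:: t1; t2] =>
      [&& concl t1 == A, concl t2 == B, nilp (discharged 0 t1)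
        & nilp (discharged 0 t2)]
  | Node (Or A B) _ [:: t1] =>
      ((concl t1 == A) || (concl t1 == B)) && nilp (discharged 0 t1)
  | Node (Imp A B) _ [:: t1] =>
      (concl t1 == B) && all (pred1 A) (discharged 0 t1)
  | _ => false
  end.

Definition reduction_for (R : tree -> Prop) (phi : tree -> option tree) : Prop :=
  forall D E, phi D = Some E ->
    [/\ R D,
        structure E /\ concl E = concl D,
        {subset assumptions E <= assumptions D}
      & forall s, assignment s D -> phi (subst s D) = Some (subst s E)].

Definition reduction (phi : tree -> option tree) : Prop :=
  exists2 R, inference_rule R & reduction_for R phi.

Definition reductions (J : (tree -> option tree) -> Prop) : Prop :=
  forall phi, J phi -> reduction phi.

(* What can be discharged: an assumption, an assumed atom, or the application of
   an assumed rule, recorded by its conclusion and premises. *)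
Inductive item :=
  | IAsm of formula
  | IAx of formula
  | IRule of formula & seq formula.

(* The items of t which are not discharged inside t.  Each comes with the node
   below t at which it is discharged ([Some 0] being the node just below the
   root of t), or with [None] if it is not discharged at all. *)
Definition free_item (i : nat) (x : item) (p : option nat) :
    seq (item * option nat) :=
  if p is Some k then if k < i then [::] else [:: (x, Some (k - i))]
  else [:: (x, None)].

Fixpoint free_items (i : nat) (t : tree) : seq (item * option nat) :=
  match t with
  | Asm A p => free_item i (IAsm A) p
  | Ax A p => free_item i (IAx A) p
  | Node A p ts =>
      free_item i (IRule A (map concl ts)) p
        ++ flatten (map (free_items i.+1) ts)
  end.

(* Replacing a sub-structure, whose free items are [src], by E: every assumption
   left undischarged in E is a copy of one of the same form in [src] and is
   discharged where that one was; an undischarged axiom or rule of E is either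
   such a copy or new, and undischarged in the latter case.  Reductions being
   arbitrary maps, the copied item is only determined up to its form; hence a
   relation, allowing every choice. *)
Definition inherit (src : seq (item * option nat)) (i : nat) (x : item)
    (p p' : option nat) : Prop :=
  if p is Some _ then p' = p else
  (exists2 q, List.In (x, q) src & p' = omap (addn i) q) \/
  (if x is IAsm _ then False else p' = None).

Inductive graft (src : seq (item * option nat)) : nat -> tree -> tree -> Prop :=
  | graft_asm i A p p' :
      inherit src i (IAsm A) p p' -> graft src i (Asm A p) (Asm A p')
  | graft_ax i A p p' :
      inherit src i (IAx A) p p' -> graft src i (Ax A p) (Ax A p')
  | graft_node i A p p' ts ts' :
      inherit src i (IRule A (map concl ts)) p p' ->
      size ts = size ts' ->
      (forall t t', List.In (t, t') (zip ts ts') -> graft src i.+1 t t') ->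
      graft src i (Node A p ts) (Node A p' ts').

Inductive replace (phi : tree -> option tree) : tree -> tree -> Prop :=
  | replace_root t E t' :
      phi (cut 0 t) = Some E -> graft (free_items 0 t) 0 E t' ->
      replace phi t t'
  | replace_sub A p ts1 t t' ts2 :
      replace phi t t' ->
      replace phi (Node A p (ts1 ++ t :: ts2)) (Node A p (ts1 ++ t' :: ts2)).

Definition reduces1 (J : (tree -> option tree) -> Prop) (D D' : tree) : Prop :=
  structure D' /\ exists2 phi, J phi & replace phi D D'.

Definition reduces (J : (tree -> option tree) -> Prop) : tree -> tree -> Prop :=
  clos_refl_trans tree (reduces1 J).

Definition judgement :=
  ((tree -> option tree) -> Prop) -> base -> tree -> Prop.

(* Reduces validity to the validity V of closed structures. *)
Definition by_instances (n : nat) (V : judgement) : judgement :=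
  fun J B D =>
  if closed_tree D then V J B D else
  forall s J' C, closed_assignment s D ->
    reductions J' -> (forall phi, J phi -> J' phi) -> base_ext n B C ->
    (forall A, A \in assumptions D -> V J' C (s A)) ->
    V J' C (subst s D).

(* Validity of closed structures with conclusion F, by recursion on F: the
   immediate sub-structures of a closed canonical structure only have immediate
   subformulas of F as conclusions and assumptions.  The clauses in their usual
   form are [valid_closed_atomic], [valid_closed_compound] and [valid_open]. *)
Fixpoint closed_valid (n : nat) (F : formula) : judgement :=
  fun J B D =>
  match F with
  | Atom _ => exists2 D', reduces J D D' & closed_derivation B D'
  | And F1 F2 | Or F1 F2 | Imp F1 F2 =>
      exists D', [/\ reduces J D D', canonical D' &
        forall D1, List.In D1 (immediate D') ->
          by_instances n
            (fun J' C E => concl E = F1 /\ closed_valid n F1 J' C E \/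
                           concl E = F2 /\ closed_valid n F2 J' C E) J B D1]
  end.

Definition valid (n : nat) : judgement :=
  by_instances n (fun J B D => closed_valid n (concl D) J B D).

Fixpoint tree_nested_ind (P : tree -> Prop)
    (PAsm : forall A p, P (Asm A p)) (PAx : forall A p, P (Ax A p))
    (PNode : forall A p ts, (forall t, List.In t ts -> P t) -> P (Node A p ts))
    (t : tree) : P t :=
  match t with
  | Asm A p => PAsm A p
  | Ax A p => PAx A p
  | Node A p ts => PNode A p ts
      ((fix all_in ts : forall t, List.In t ts -> P t :=
          match ts with
          | [::] => fun t (H : False) => match H with end
          | u :: us => fun t H =>
              match H with
              | or_introl e =>
                  eq_ind u P (tree_nested_ind PAsm PAx PNode u) t e
              | or_intror H' => all_in us t H'
              end
          end) ts)
  end.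

Lemma in_flatten_map (T : Type) (U : Type) (f : T -> seq U) (s : seq T) (y : U) :
  List.In y (flatten (map f s)) <-> exists2 x, List.In x s & List.In y (f x).
Proof.
elim: s => [|x s IH] /=; first by split=> // -[].
have -> : f x ++ flatten (map f s) = app (f x) (flatten (map f s)) by [].
rewrite List.in_app_iff IH; split.
  by move=> [H|[z zs yz]]; [exists x; [left|] | exists z; [right|]].
by move=> [z [<-|zs] yz]; [left | right; exists z].
Qed.

Lemma inP (T : eqType) (x : T) (s : seq T) : x \in s <-> List.In x s.
Proof.
elim: s => [|y s IH] //=; rewrite inE; split.
  by case/orP => [/eqP ->|/IH]; [left|right].
by case=> [->|/IH ->]; rewrite ?eqxx ?orbT.
Qed.

Lemma assumptions_free t i A :
  A \in assumptions t <-> List.In (IAsm A, None) (free_items i t).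
Proof.
elim/tree_nested_ind: t i => [F p|F p|F p ts IH] i /=.
- case: p => [k|] /=; last by rewrite inE; split=> [/eqP ->|[[->]|//]]; [left|].
  by case: ifP => // _; split=> //; case.
- by split=> //; case: p => [k|] /=; [case: ifP => // _|]; case.
- split=> [/inP/in_flatten_map [t ts_t /inP]|].
    move=> /(IH _ ts_t i.+1) H; apply/List.in_app_iff; right.
    by apply/in_flatten_map; exists t.
  case/List.in_app_iff => [|/in_flatten_map [t ts_t /(IH _ ts_t) H]].
    by case: p => [k|] /=; [case: ifP => // _|]; case.
  by apply/inP/in_flatten_map; exists t => //; apply/inP.
Qed.

Lemma discharged_free t i d A :
  A \in discharged (d + i) t <-> List.In (IAsm A, Some d) (free_items i t).
Proof.
elim/tree_nested_ind: t i => [F p|F p|F p ts IH] i /=.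
- case: p => [k|] /=; last by split=> //; case.
  case: eqP => [[->]|neq].
    rewrite ltnNge leq_addl addnK inE.
    by split=> [/eqP ->|[[->]|//]]; [left|].
  split=> //; case: ltnP => //= ik [[_ dE]|//].
  by case: neq; rewrite -dE subnK.
- by split=> //; case: p => [k|] /=; [case: ifP => // _|]; case.
- split=> [/inP/in_flatten_map [t ts_t /inP]|].
    rewrite -addnS => /(IH _ ts_t i.+1) H; apply/List.in_app_iff; right.
    by apply/in_flatten_map; exists t.
  case/List.in_app_iff => [|/in_flatten_map [t ts_t /(IH _ ts_t) H]].
    by case: p => [k|] /=; [case: ifP => // _|]; case.
  by apply/inP/in_flatten_map; exists t => //; apply/inP; rewrite -addnS.
Qed.

Lemma cut_free t i A : A \in assumptions (cut i t) ->
  exists q, List.In (IAsm A, q) (free_items i t).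
Proof.
elim/tree_nested_ind: t i => [F p|F p|F p ts IH] i //=.
- case: p => [k|] /=; last by rewrite inE => /eqP ->; exists None; left.
  by case: ltnP => //= _; rewrite inE => /eqP ->; exists (Some (k - i)); left.
- move=> /inP/in_flatten_map [_ /List.in_map_iff [t [<- ts_t]] /inP].
  case/(IH _ ts_t) => q qt; exists q; apply/List.in_app_iff; right.
  by apply/in_flatten_map; exists t.
Qed.

Lemma allIn (T : Type) (a : pred T) s x : all a s -> List.In x s -> a x.
Proof. by elim: s => //= y s IH /andP [ay /IH as_] [<-|/as_]. Qed.

Lemma wf_free t env i A k : wf_under env t ->
  List.In (IAsm A, Some k) (free_items i t) -> k + i < size env.
Proof.
elim/tree_nested_ind: t env i => [F p|F p|F p ts IH] env i /=.
- case: p => [j|] /=; last by move=> _ [].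
  case: (ltnP j i) => /= ij jlt; first by case.
  by case=> [[_ <-]|//]; rewrite subnK.
- by move=> _; case: p => [j|] /=; [case: ifP => // _|]; case.
- case/and3P=> _ _ wf_ts /List.in_app_iff [].
    by case: p => [j|] /=; [case: ifP => // _|]; case.
  case/in_flatten_map => t ts_t /(IH _ ts_t _ _ (allIn wf_ts ts_t)) /=.
  by rewrite addnS ltnS.
Qed.

Lemma free_shift t i j x q : List.In (x, q) (free_items (i + j) t) <->
  List.In (x, omap (addn i) q) (free_items j t).
Proof.
have base_case y j' p : List.In (x, q) (free_item (i + j') y p) <->
    List.In (x, omap (addn i) q) (free_item j' y p).
  case: p => [k|] /=; last first.
    split=> [[[-> <-]|//]|[[-> e]|//]]; first by left.
    by left; case: q e.
  case: (ltnP k j') => [kj|jk].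
    by rewrite (leq_trans kj (leq_addl _ _)).
  case: ltnP => ijk; split=> //=.
  - case=> [[_]|//]; case: q => //= d [e].
    by move: ijk; rewrite -(subnK jk) e ltn_add2r ltnNge leq_addr.
  - by case=> [[-> <-]|//]; left; rewrite /= [i + j']addnC subnDA subnKC ?leq_subRL // addnC.
  - case=> [[-> ]|//]; case: q => //= d [e]; left.
    by rewrite addnC subnDA e addKn.
elim/tree_nested_ind: t j => [F p|F p|F p ts IH] j //=.
split=> /List.in_app_iff [H|/in_flatten_map [t ts_t H]];
  apply/List.in_app_iff.
- by left; apply/base_case.
- by right; apply/in_flatten_map; exists t => //; apply/IH; rewrite ?addnS.
- by left; apply/base_case.
- by right; apply/in_flatten_map; exists t => //; rewrite -addnS; apply/IH.
Qed.

Lemma in_zip2 (T U : Type) (s : seq T) (s' : seq U) y : size s = size s' ->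
  List.In y s' -> exists x, List.In (x, y) (zip s s') /\ List.In x s.
Proof.
elim: s s' => [|x s IH] [|z s'] //= [e] [->|H]; first by exists x; split; left.
by have [u [? ?]] := IH _ e H; exists u; split; right.
Qed.

Lemma graft_free src i E t' A q env : graft src i E t' -> wf_under env E ->
  size env = i -> List.In (IAsm A, q) (free_items i t') ->
  List.In (IAsm A, q) src.
Proof.
move=> G; elim: G env A q => {i E t'}
    [i F p p' H|i F p p' H|i F p p' ts ts' H sz G IH] env A q /=.
- case: p H => [k -> klt <- /=|]; first by rewrite klt.
  case=> // -[q' qs ->] _ _; case: q' qs => [k|] /= qs.
    by rewrite ltnNge leq_addr addKn => -[[<- <-]|//].
  by case=> [[<- <-]|//].
- by move=> _ _; case: p' {H} => [k|] /=; [case: ifP => // _|]; case.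
- case/and3P=> _ _ wf_ts sz_env /List.in_app_iff [].
    by case: p' {H} => [k|] /=; [case: ifP => // _|]; case.
  case/in_flatten_map => t' ts_t'.
  have [t [tt' ts_t]] := in_zip2 sz ts_t'.
  by apply: (IH t t' tt' (atomic_node F ts :: env)) (allIn wf_ts ts_t) _ => /=; rewrite sz_env.
Qed.

Lemma concl_cut d t : concl (cut d t) = concl t. Proof. by case: t. Qed.

Lemma graft_concl src i E t' : graft src i E t' -> concl t' = concl E.
Proof. by case. Qed.

Lemma replace_free phi t t' : reduction phi -> replace phi t t' ->
  concl t' = concl t /\
  forall A q, List.In (IAsm A, q) (free_items 0 t') ->
              List.In (IAsm A, q) (free_items 0 t).
Proof.
case=> R _ phiR; elim=> {t t'} [t E t' phiE G|A p ts1 t t' ts2 _ [IHc IH]].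
  have [_ [wfE concE] _ _] := phiR _ _ phiE.
  split; first by rewrite (graft_concl G) concE concl_cut.
  by move=> A q; apply: graft_free G wfE _.
split=> //= F q /List.in_app_iff H; apply/List.in_app_iff; case: H.
  by case: p => [k|] /=; [|case]; case.
move=> /in_flatten_map [u H Hu]; right; apply/in_flatten_map; move: H Hu.
move=> /List.in_app_iff [H1|[<-|H2]] Hu.
- by exists u => //; apply/List.in_app_iff; left.
- exists t; first by apply/List.in_app_iff; right; left.
  by move: Hu; rewrite -[1]/(1 + 0) => /free_shift/IH/free_shift.
- by exists u => //; apply/List.in_app_iff; right; right.
Qed.

Lemma reduces_from J D D' : reductions J -> reduces J D D' ->
  concl D' = concl D /\ {subset assumptions D' <= assumptions D}.
Proof.
move=> JR; elim=> {D D'} [D D' [_ [phi Jphi]]|D|D D' D'' _ [c1 s1] _ [c2 s2]].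
- move=> /(replace_free (JR _ Jphi)) [c H]; split=> // A.
  by move=> /(assumptions_free _ 0)/H/assumptions_free.
- by split.
- by split; [rewrite c2|move=> A /s2/s1].
Qed.

Lemma closedP t : closed_tree t <-> forall A, A \notin assumptions t.
Proof.
rewrite /closed_tree; case: (assumptions t) => [|A s] //=.
by split=> // /(_ A); rewrite mem_head.
Qed.

Lemma subst_closed s D : closed_assignment s D ->
  concl (subst s D) = concl D /\ closed_tree (subst s D).
Proof.
case=> sD sC; split.
  case: D sD {sC} => [A [k|]|A p|A p ts] //= /(_ A).
  by rewrite mem_head => /(_ isT) [].
apply/closedP => A; apply/negP; have {}sD F : F \in assumptions D ->
   closed_tree (s F) by exact: sC.
elim/tree_nested_ind: D {sC} sD => [F [k|]|F p|F p ts IH] //= sC.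
  by have /sC/closedP/(_ A)/negP : F \in [:: F] by rewrite mem_head.
move=> /inP/in_flatten_map [_ /List.in_map_iff [t [<- ts_t]] /inP].
apply: IH => // G Gt; apply: sC; apply/inP/in_flatten_map.
by exists t => //; apply/inP.
Qed.

Lemma canonical_immediate D D1 : canonical D -> closed_tree D ->
  List.In D1 (immediate D) ->
  match concl D with
  | Atom _ => False
  | And F1 F2 | Or F1 F2 | Imp F1 F2 =>
    (concl D1 = F1 \/ concl D1 = F2) /\ {subset assumptions D1 <= [:: F1]}
  end.
Proof.
have sub env t ts b A p : all (wf_under [:: b]) ts -> List.In t ts ->
    closed_tree (Node A p ts) -> env = discharged 0 t ->
    {subset assumptions (cut 0 t) <= env}.
  move=> wf_ts ts_t clD -> F /cut_free [[k|] H].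
    have := wf_free (allIn wf_ts ts_t) H; rewrite addn0 ltnS leqn0 => /eqP k0.
    by rewrite -[0]/(0 + 0); apply/discharged_free; rewrite -k0 in H *.
  move/closedP/(_ F)/negP: clD; case; rewrite /=.
  apply/inP/in_flatten_map; exists t => //; apply/inP.
  by apply/(assumptions_free _ 0).
rewrite /canonical; case: D => [//|F p|F p ts] /andP [wfD]; first by case: F wfD.
case/and3P: (wfD) => _ _ wf_ts.
case: F wfD wf_ts => [//|F1 F2|F1 F2|F1 F2] _; case: ts => [|t1 [|t2 [|? ?]]] //.
- move=> wf_ts /and4P [/eqP c1 /eqP c2 d1 d2] cl /= H; split.
    by case: H => [<-|[<-|//]]; rewrite concl_cut; [left|right].
  case: H => [<-|[<-|//]] A HA.
    by have := sub _ t1 _ _ _ _ wf_ts (or_introl erefl) cl erefl A HA;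
      rewrite (nilP d1).
  by have := sub _ t2 _ _ _ _ wf_ts (or_intror (or_introl erefl)) cl erefl A HA;
    rewrite (nilP d2).
- move=> wf_ts /andP [c1 d1] cl /= [<-|//]; rewrite concl_cut; split.
    by case/orP: c1 => /eqP ->; [left|right].
  move=> A HA; have := sub _ t1 _ _ _ _ wf_ts (or_introl erefl) cl erefl A HA.
  by rewrite (nilP d1).
- move=> wf_ts /andP [/eqP c1 /allP d1] cl /= [<-|//].
  rewrite concl_cut; split; first by right.
  move=> A HA; have := sub _ t1 _ _ _ _ wf_ts (or_introl erefl) cl erefl A HA.
  by move/d1 => /= /eqP ->; rewrite mem_head.
Qed.

Lemma by_instances_ext n (V V' : judgement) (P : formula -> Prop) J B D :
  (forall J C E, P (concl E) -> V J C E <-> V' J C E) ->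
  P (concl D) -> (forall A, A \in assumptions D -> P A) ->
  by_instances n V J B D <-> by_instances n V' J B D.
Proof.
move=> VV PD PA; rewrite /by_instances; case: ifP => _; first exact: VV.
split=> H s J' C sD RJ JJ BC Vs;
  have [cE _] := subst_closed sD; (have := H s J' C sD RJ JJ BC);
  (have Vs' := (fun A AD => let: conj (conj _ e) _ := conj (sD.1 A AD) I in e));
  move=> HH; apply/(VV _ _ _); rewrite ?cE //; apply: HH => A AD;
  apply/VV; rewrite ?Vs' //; [exact: PA| exact: Vs| exact: PA | exact: Vs].
Qed.

(* The three clauses of the usual definition of validity. *)
Lemma valid_closed_atomic n J B D :
  closed_tree D -> atomic (concl D) ->
  valid n J B D <-> exists2 D', reduces J D D' & closed_derivation B D'.
Proof. by rewrite /valid /by_instances => ->; case: (concl D). Qed.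

Lemma valid_closed_compound n J B D :
  reductions J -> closed_tree D -> ~~ atomic (concl D) ->
  valid n J B D <->
  exists D', [/\ reduces J D D', canonical D' &
    forall D1, List.In D1 (immediate D') -> valid n J B D1].
Proof.
move=> JR clD; rewrite {1}/valid /by_instances clD.
have key D' D1 F1 F2 : reduces J D D' -> canonical D' ->
    concl D = And F1 F2 \/ concl D = Or F1 F2 \/ concl D = Imp F1 F2 ->
    List.In D1 (immediate D') ->
    by_instances n
      (fun J' C E => concl E = F1 /\ closed_valid n F1 J' C E \/
                     concl E = F2 /\ closed_valid n F2 J' C E) J B D1 <->
    valid n J B D1.
  move=> DD' canD' cD immD1.
  have [cD' aD'] := reduces_from JR DD'.
  have clD' : closed_tree D'.
    apply/closedP => A; apply/negP => /aD'; apply/negP.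
    by move/closedP/(_ A): clD.
  have := canonical_immediate canD' clD' immD1; rewrite cD' => H.
  have {H} [cD1 aD1] : (concl D1 = F1 \/ concl D1 = F2) /\
      {subset assumptions D1 <= [:: F1]} by case: cD H => [|[|]] ->.
  apply: (@by_instances_ext n _ _ (fun F => F = F1 \/ F = F2)) => //.
    move=> J' C E [] ->; split.
    - by case=> [[_ H]|[-> H]].
    - by left.
    - by case=> [[-> H]|[_ H]].
    - by right.
  by move=> A /aD1; rewrite inE => /eqP ->; left.
case cD: (concl D) => [a|F1 F2|F1 F2|F1 F2] // _ /=;
  split=> -[D' [DD' canD' H]]; exists D'; split=> // D1 immD1;
  have {}key := key D' D1 F1 F2 DD' canD' ltac:(auto) immD1;
  by apply/key/H.
Qed.

Lemma valid_open n J B D : ~~ closed_tree D ->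
  valid n J B D <->
  forall s J' C, closed_assignment s D ->
    reductions J' -> (forall phi, J phi -> J' phi) -> base_ext n B C ->
    (forall A, A \in assumptions D -> valid n J' C (s A)) ->
    valid n J' C (subst s D).
Proof.
move=> opD; rewrite {1}/valid {1}/by_instances (negbTE opD).
split=> H s J' C sD RJ JJ BC Vs; have [_ clE] := subst_closed sD;
  (have := H s J' C sD RJ JJ BC); rewrite /valid /by_instances clE;
  apply => A AD; have := Vs A AD;
  by rewrite /valid /by_instances (sD.2 A AD).
Qed.

Definition reducibility_consequence (n : nat) (B : base) (G : seq formula)
    (A : formula) : Prop :=
  exists D J, [/\ structure D, reductions J,
    assumptions D =i G /\ concl D = A & valid n J B D].

Definition add_rules (B : base) (Rs : seq rule) : base :=
  fun R => B R \/ List.In R Rs.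

Inductive IL : base -> seq formula -> formula -> Prop :=
  | IL_asm B G A : A \in G -> IL B G A
  | IL_andI B G A1 A2 : IL B G A1 -> IL B G A2 -> IL B G (And A1 A2)
  | IL_andE1 B G A1 A2 : IL B G (And A1 A2) -> IL B G A1
  | IL_andE2 B G A1 A2 : IL B G (And A1 A2) -> IL B G A2
  | IL_orI1 B G A1 A2 : IL B G A1 -> IL B G (Or A1 A2)
  | IL_orI2 B G A1 A2 : IL B G A2 -> IL B G (Or A1 A2)
  | IL_orE B G A1 A2 A : IL B G (Or A1 A2) ->
      IL B (A1 :: G) A -> IL B (A2 :: G) A -> IL B G A
  | IL_impI B G A1 A2 : IL B (A1 :: G) A2 -> IL B G (Imp A1 A2)
  | IL_impE B G A1 A2 : IL B G (Imp A1 A2) -> IL B G A1 -> IL B G A2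
  | IL_botE B G A : IL B G (Atom Bot) -> IL B G A
  | IL_rule B G ps a :
      B (Rule ps a) ->
      (forall Rs b, List.In (Rs, b) ps -> IL (add_rules B Rs) G (Atom b)) ->
      IL B G (Atom a).

Definition base_complete (n : nat)
    (conseq : base -> seq formula -> formula -> Prop) : Prop :=
  forall (B : base) (G : seq formula) (A : formula),
    base_le n B -> conseq B G A -> IL B G A.

(* Main.v *)
Require Import Defs.
From Stdlib Require Import List Relations.
From mathcomp Require Import all_boot.

Set Implicit Arguments.
Unset Strict Implicit.
Unset Printing Implicit Defensive.

(** For letters p, q, r, consider the consequence
      p -> (q \/ r)  |=  (p -> q) \/ (p -> r)
    over the base that has only the explosion rules.

    It holds in the standard semantics, for every n: if p -> (q \/ r) holds on
    a base C, then it may be applied on C extended with the axiom p, a rule of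
    level 0; so that extension derives q, say.  Every extension E of C which
    derives p then derives q, because a derivation of p in E can be plugged in
    for the axiom p ([derivable_cut]).  Hence p -> q holds on C.

    It also holds in the reducibility semantics, because
    [standard_reducibility] makes every standard consequence a reducibility
    consequence.  The justification is the set of all reductions.  A map which
    is defined on closed structures only commutes with substitution for trivial
    reasons, so that any closed structure reduces to any other one with the
    same conclusion ([reduces_closed]); and no set of reductions extends this
    one properly.  By induction on the conclusion, a closed structure is then
    valid exactly when its conclusion holds in the standard semantics
    ([closed_valid_sat]).

    It is not derivable in intuitionistic logic with the explosion rules:
    these are sound for Kripke models ([IL_sound]), and a root with two
    incomparable successors, one forcing p and q, the other p and r, is a
    countermodel. *)

(** * Derivations in atomic bases *)

Lemma In_zip_map (T U V : Type) (f : U -> V) (s : seq T) (s' : seq U) q v :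
  List.In (q, v) (zip s (map f s')) ->
  exists2 u, v = f u & List.In (q, u) (zip s s').
Proof.
elim: s s' => [|x s IH] [|y s'] //= [[<- <-]|/IH [u -> H]].
  by exists y => //; left.
by exists u => //; right.
Qed.

Lemma derivation_weaken B C env env' t : (forall R, B R -> C R) ->
  derivation B env t -> derivation C (env ++ env') t.
Proof.
move=> BC.
have avail e R p : available B e R p -> available C (e ++ env') R p.
  case: p => [k|] /=; last exact: BC.
  by rewrite nth_cat; case: ltnP => // ek; rewrite nth_default.
elim=> {env t} [env a p av|env ps a p ts ps0 av cts _ IH].
  by apply: der_axiom; apply: avail.
by apply: (der_rule ps0) => //; apply: avail.
Qed.

Lemma derivable_mono B C a : (forall R, B R -> C R) ->
  derivable B a -> derivable C a.
Proof.
move=> BC [t dt ct]; exists t => //.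
by have := derivation_weaken [::] BC dt.
Qed.

(** The tree t in which the undischarged axioms a are replaced by u. *)
Fixpoint plug (a : atom) (u t : tree) : tree :=
  match t with
  | Ax (Atom b) None => if b == a then u else t
  | Node A p ts => Node A p (map (plug a u) ts)
  | _ => t
  end.

Lemma concl_plug a u t : concl u = Atom a -> concl (plug a u t) = concl t.
Proof. by move=> cu; case: t => // -[b|? ?|? ?|? ?] [k|] //=; case: eqP => [->|]. Qed.

Lemma derivation_plug B C a u env t : (forall R, B R -> C R) ->
  closed_derivation C u -> concl u = Atom a ->
  derivation (add_rules B [:: Rule [::] a]) env t ->
  derivation C env (plug a u t).
Proof.
move=> BC du cu; elim=> {env t} [env b p av|env ps b p ts ps0 av cts _ IH] /=.
- case: p av => [k|] av; first exact: der_axiom.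
  case: eqP => [_|neq].
    by have := derivation_weaken env (fun R (H : C R) => H) du.
  apply: der_axiom; apply: BC; case: av => [//|[[e]|//]].
  by case: neq.
- apply: (der_rule ps0) => //.
  + case: p av => [k|] //= [/BC//|[[e]|//]].
    by case: ps0.
  + by rewrite -cts -map_comp; apply: eq_map => t /=; apply: concl_plug.
  + by move=> q t' qt'; have [t -> qt] := In_zip_map qt'; apply: IH.
Qed.

(** A derivable axiom can be eliminated. *)
Lemma derivable_cut B C a b : (forall R, B R -> C R) ->
  derivable (add_rules B [:: Rule [::] a]) b -> derivable C a -> derivable C b.
Proof.
move=> BC [t dt ct] [u du cu]; exists (plug a u t).
  exact: derivation_plug dt.
by rewrite concl_plug.
Qed.

Lemma discharged_derivation B env t : derivation B env t ->
  (forall d, discharged d t = [::]) /\ assumptions t = [::].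
Proof.
elim=> {env t} // env ps a p ts _ _ cts _ IH /=.
have sz : size ps = size ts by rewrite -(size_map concl) cts size_map.
have flat0 (f : tree -> seq formula) :
    (forall q t, List.In (q, t) (zip ps ts) -> f t = [::]) ->
    flatten (map f ts) = [::].
  elim: (ps) (ts) sz => [|q ps' IHps] [|t ts'] //= [sz'] f0.
  rewrite (f0 q t (or_introl erefl)) IHps // => q' t' H.
  by apply: (f0 q' t'); right.
split=> [d|]; apply: flat0 => q t /IH [] //.
Qed.

Lemma all_In (T : Type) (a : pred T) (s : seq T) :
  (forall x, List.In x s -> a x) -> all a s.
Proof.
elim: s => //= x s IH H; rewrite (H x (or_introl erefl)) IH // => y ys.
by apply: H; right.
Qed.

Lemma derivation_wf B env t : derivation B env t ->
  wf_under (nseq (size env) true) t.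
Proof.
have nth_avail e R k : available B e R (Some k) ->
    nth false (nseq (size e) true) k.
  by rewrite nth_nseq /=; case: ltnP => // ek; rewrite nth_default.
elim=> {env t} [env a [k|] //= /nth_avail //|env ps a p ts ps0 av cts der IH] /=.
have sz : size ps = size ts by rewrite -(size_map concl) cts size_map.
have at_node : atomic_node (Atom a) ts.
  apply/and3P; split=> //.
    have := cts; elim: (ts) (ps) {cts sz der IH ps0 av} => [|t ts' IHts] [|q ps'] //=.
    by case=> -> /IHts ->.
  apply/nilP; case E: (flatten _) => [//|F s].
  have /in_flatten_map [t ts_t] : List.In F (flatten (map (discharged 0) ts)).
    by rewrite E; left.
  have [q [qt _]] := in_zip2 sz ts_t.
  by have [-> _] := discharged_derivation (der _ _ qt).
rewrite at_node; apply/and3P; split.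
- by case: (ts) sz ps0 => //; case: (ps).
- by case: p av => [k|] // /nth_avail.
- apply: all_In => t ts_t.
  by have [q [/IH]] := in_zip2 sz ts_t.
Qed.

(** * Reduction of closed structures *)

Lemma wf_weaken env env' t : wf_under env t -> wf_under (env ++ env') t.
Proof.
elim/tree_nested_ind: t env => [A p|A p|A p ts IH] env /=.
- case: p => [k|//]; rewrite size_cat => H; exact: ltn_addr.
- case: p => [k|//] /andP [-> H]; rewrite nth_cat.
  by case: ltnP H => // ek; rewrite nth_default.
- case/and3P=> -> Hp Hts; apply/and3P; split=> //.
    case: p Hp => [k|//] /andP [-> H]; rewrite nth_cat.
    by case: ltnP H => // ek; rewrite nth_default.
  apply: all_In => t ts_t; rewrite -cat_cons.
  exact: IH ts_t _ (allIn Hts ts_t).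
Qed.

Lemma structure_wf env t : structure t -> wf_under env t.
Proof. exact: (@wf_weaken [::]). Qed.

Lemma map_id_In (T : Type) (f : T -> T) (s : seq T) :
  (forall x, List.In x s -> f x = x) -> map f s = s.
Proof.
elim: s => //= x s IH H; rewrite (H x (or_introl erefl)) IH // => y ys.
by apply: H; right.
Qed.

Lemma cut_wf env t : wf_under env t -> cut (size env) t = t.
Proof.
have cut_nth b e k : b && nth false e k -> cut_ptr (size e) (Some k) = Some k.
  by case/andP=> _ H /=; case: ltnP H => // ek; rewrite nth_default.
elim/tree_nested_ind: t env => [A [k|]|A [k|]|A p ts IH] env //=.
- by move=> ->.
- by move=> /cut_nth /= ->.
- case/and3P=> _ Hp Hts; congr Node; first by case: p Hp => // k /cut_nth.
  apply: map_id_In => t ts_t.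
  exact: IH ts_t (_ :: env) (allIn Hts ts_t).
Qed.

Lemma closed_subst s t : closed_tree t -> subst s t = t.
Proof.
elim/tree_nested_ind: t => [A [k|]|A p|A p ts IH] // clt /=.
congr Node; apply: map_id_In => t ts_t; apply: (IH _ ts_t).
apply/closedP => F; apply/negP => Ft; move/closedP/(_ F)/negP: clt; case.
by apply/inP/in_flatten_map; exists t => //; apply/inP.
Qed.

Lemma graft_closed src i t : closed_tree t -> graft src i t t.
Proof.
elim/tree_nested_ind: t i => [A [k|]|A p|A p ts IH] i // clt.
- exact: graft_asm.
- by apply: graft_ax; case: p {clt} => //; right.
- apply: graft_node => //; first by case: p {clt} => //; right.
  move=> t t' tt'; have [-> ts_t] : t = t' /\ List.In t' ts.
    elim: (ts) tt' => //= u us IHus [[-> ->]|/IHus [-> H]]; first by split; [|left].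
    by split=> //; right.
  apply: (IH _ ts_t); apply/closedP => F; apply/negP => Ft.
  move/closedP/(_ F)/negP: clt; case.
  by apply/inP/in_flatten_map; exists t' => //; apply/inP.
Qed.

(** The reduction that sends every closed structure with the same conclusion as
    E to E. *)
Definition jump (E t : tree) : option tree :=
  if [&& is_inference t, closed_tree t & concl t == concl E] then Some E
  else None.

Lemma jump_reduction E : structure E -> closed_tree E -> reduction (jump E).
Proof.
move=> sE clE; exists is_inference => // D E'.
rewrite /jump; case: ifP => // /and3P [iD clD /eqP cD] [<-]; split=> //.
  by move=> A; rewrite (nilP clE).
by move=> s _; rewrite !closed_subst // iD clD cD eqxx.
Qed.

(** When all reductions are allowed, closed structures with the same conclusion
    reduce to each other. *)
Lemma reduces_closed (J : (tree -> option tree) -> Prop) D E :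
  (forall phi, reduction phi -> J phi) ->
  structure D -> closed_tree D -> structure E -> closed_tree E ->
  concl D = concl E -> reduces J D E.
Proof.
move=> JR sD clD sE clE cDE; apply: rt_step; split=> //.
exists (jump E); first by apply/JR/jump_reduction.
apply: (@replace_root _ _ E); last exact: graft_closed.
rewrite (cut_wf sD) /jump /is_inference sD clD cDE eqxx.
by case: D sD clD {cDE} => // A [k|].
Qed.

Lemma reduces_concl_closed J D D' : reductions J -> reduces J D D' -> closed_tree D ->
  concl D' = concl D /\ closed_tree D'.
Proof.
move=> JR DD' clD; have [cD' aD'] := reduces_from JR DD'; split=> //.
by apply/closedP => A; apply/negP => /aD'; rewrite (nilP clD).
Qed.

(** * Standard consequence implies reducibility consequence *)

Lemma base_ext_trans n B C E : base_ext n B C -> base_ext n C E ->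
  base_ext n B E.
Proof. by move=> [BC _] [CE lE]; split=> // R /BC/CE. Qed.

Lemma sat_mono n A B C : base_ext n B C -> sat n A B -> sat n A C.
Proof.
move=> BC; elim: A => [a|A1 IH1 A2 IH2|A1 IH1 A2 IH2|A1 _ A2 _] /=.
- by case: BC => BC _; apply: derivable_mono.
- by case=> /IH1 H1 /IH2 H2.
- by case=> [/IH1|/IH2]; [left|right].
- by move=> H E CE; apply: H; apply: base_ext_trans CE.
Qed.

Lemma cut_closed b t : wf_under [:: b] t -> closed_tree t ->
  nilp (discharged 0 t) -> closed_tree (cut 0 t).
Proof.
move=> wft clt dt; apply/closedP => F; apply/negP => /cut_free [[k|] H].
  have := wf_free wft H; rewrite addn0 ltnS leqn0 => /eqP k0.
  move: H; rewrite k0 => /(discharged_free t 0 0).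
  by rewrite (nilP dt).
by move/(assumptions_free t 0): H; rewrite (nilP clt).
Qed.

(** The one-step inference of A from the premises G. *)
Definition inference_from (G : seq formula) (A : formula) : tree :=
  Node A None (map (Asm^~ None) G).

Lemma assumptions_inference_from G A :
  assumptions (inference_from G A) = G.
Proof. by rewrite /=; elim: G => //= F G ->. Qed.

Lemma structure_inference_from G A : ~~ nilp G ->
  structure (inference_from G A).
Proof.
rewrite /structure /= => G0; apply/andP; split=> //; first by case: G G0.
by apply: all_In => _ /List.in_map_iff [F [<- _]].
Qed.

Lemma structure_subst_inference_from s G A : ~~ nilp G ->
  assignment s (inference_from G A) ->
  structure (subst s (inference_from G A)).
Proof.
rewrite /assignment assumptions_inference_from /structure /= => G0 sG.
apply/andP; split=> //; first by case: G G0 {sG}.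
rewrite -map_comp; apply: all_In => _ /List.in_map_iff [F [<- /inP FG]] /=.
exact: structure_wf (sG F FG).1.
Qed.

(** When J consists of all reductions, a closed structure is valid if and only
    if its conclusion holds in the standard semantics.  The two directions are
    kept apart because the first one also applies to trees that are not known
    to be structures, such as the immediate sub-structures of a canonical
    structure. *)
Lemma closed_valid_sat n F :
  (forall J B D, (forall phi, J phi <-> reduction phi) -> concl D = F ->
     closed_tree D -> valid n J B D -> sat n F B) /\
  (forall J B D, (forall phi, J phi <-> reduction phi) -> concl D = F ->
     structure D -> closed_tree D -> sat n F B -> valid n J B D).
Proof.
have red (J : (tree -> option tree) -> Prop) :
    (forall phi, J phi <-> reduction phi) ->
    reductions J /\ forall phi, reduction phi -> J phi.
  by move=> H; split=> phi /H.
elim: F => [a|F1 [S1 V1] F2 [S2 V2]|F1 [S1 V1] F2 [S2 V2]|F1 [S1 V1] F2 [S2 V2]];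
  split=> J B D HJ cD; have [JR RJ] := red _ HJ.
- move=> clD; rewrite valid_closed_atomic ?cD // => -[D' DD' dD'].
  by exists D' => //; rewrite (reduces_from JR DD').1.
- move=> sD clD [D' dD' cD']; rewrite valid_closed_atomic ?cD //.
  exists D' => //; apply: reduces_closed => //.
  + exact: derivation_wf dD'.
  + by apply/nilP; case: (discharged_derivation dD').
  + by rewrite cD'.
- move=> clD; rewrite valid_closed_compound ?cD // => -[D' [DD' canD' H]].
  have [cD' clD'] := reduces_concl_closed JR DD' clD.
  move: canD' clD' H; rewrite cD in cD'; case: D' cD' {DD'} => [A p|A p|A p ts] /= ->;
    rewrite /canonical /structure ?andbF //=.
  case: ts => [|t1 [|t2 [|? ?]]]; rewrite ?andbF //.
  case/andP=> /and3P [_ _ /= /and3P [w1 w2 _]] /and4P [/eqP c1 /eqP c2 d1 d2].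
  rewrite /closed_tree /= cats0 => cl H.
  have [cl1 cl2] : closed_tree t1 /\ closed_tree t2.
    by move: cl; rewrite /closed_tree /nilp size_cat addn_eq0 => /andP [].
  split.
    apply: (S1 J B (cut 0 t1)); rewrite ?concl_cut //; first exact: cut_closed w1 _ _.
    by apply: H; left.
  apply: (S2 J B (cut 0 t2)); rewrite ?concl_cut //; first exact: cut_closed w2 _ _.
  by apply: H; right; left.
- move=> sD clD [s1 s2]; rewrite valid_closed_compound ?cD //.
  exists (Node (And F1 F2) None [:: Ax F1 None; Ax F2 None]); split.
  + exact: reduces_closed.
  + by rewrite /canonical /= !eqxx.
  + by move=> D1 /= [<-|[<-|//]]; [apply: V1|apply: V2].
- move=> clD; rewrite valid_closed_compound ?cD // => -[D' [DD' canD' H]].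
  have [cD' clD'] := reduces_concl_closed JR DD' clD.
  move: canD' clD' H; rewrite cD in cD'; case: D' cD' {DD'} => [A p|A p|A p ts] /= ->;
    rewrite /canonical /structure ?andbF //=.
  case: ts => [|t1 [|? ?]]; rewrite ?andbF //.
  case/andP=> /and3P [_ _ /= /andP [w1 _]] /andP [c1 d1].
  rewrite /closed_tree /= cats0 => cl1 H.
  have cl : closed_tree (cut 0 t1) by exact: cut_closed w1 _ _.
  have {}H := H _ (or_introl erefl).
  case/orP: c1 => /eqP c1; [left; apply: S1 H|right; apply: S2 H] => //;
    by rewrite concl_cut.
- move=> sD clD sF; rewrite valid_closed_compound ?cD //.
  case: sF => s1; [exists (Node (Or F1 F2) None [:: Ax F1 None])
                  |exists (Node (Or F1 F2) None [:: Ax F2 None])]; split.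
  + exact: reduces_closed.
  + by rewrite /canonical /= !eqxx.
  + by move=> D1 /= [<-|//]; apply: V1.
  + exact: reduces_closed.
  + by rewrite /canonical /= !eqxx orbT.
  + by move=> D1 /= [<-|//]; apply: V2.
- move=> clD; rewrite valid_closed_compound ?cD // => -[D' [DD' canD' H]] C BC s1.
  have [cD' clD'] := reduces_concl_closed JR DD' clD.
  have imm D1 := canonical_immediate canD' clD' (D1 := D1).
  move: canD' clD' H imm; rewrite cD in cD'; case: D' cD' {DD'} => [A p|A p|A p ts] /= ->;
    rewrite /canonical /structure ?andbF //=.
  case: ts => [|t1 [|? ?]]; rewrite ?andbF //.
  move=> /and3P [_ /eqP c1 _] _ H imm.
  have {}H := H _ (or_introl erefl).
  have [_ {imm} aD1] := imm _ (or_introl erefl).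
  have c1' : concl (cut 0 t1) = F2 by rewrite concl_cut.
  have [cl|op] := boolP (closed_tree (cut 0 t1)).
    by apply: sat_mono BC _; apply: S2 H.
  (* An axiom leaf is a closed structure whatever its label, so it serves as an
     instance of the assumption F1. *)
  have as_s : closed_assignment (fun A => Ax A None) (cut 0 t1) by [].
  have [cs cls] := subst_closed as_s.
  apply: (S2 J C _ HJ _ cls); first by rewrite cs.
  move/(valid_open n J B op): H; apply=> // F /aD1.
  by rewrite inE => /eqP ->; apply: V1.
- move=> sD clD sF; rewrite valid_closed_compound ?cD //.
  (* The pointer 1 of the assumption skips the node F2: the discharge takes
     place at the root. *)
  exists (Node (Imp F1 F2) None [:: Node F2 None [:: Asm F1 (Some 1)]]); split.
  + exact: reduces_closed.
  + by rewrite /canonical /= !eqxx.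
  + move=> _ /= [<-|//]; rewrite -[Node _ _ _]/(inference_from [:: F1] F2).
    apply/valid_open => // s J' C cs RJ' JJ' BC Vs.
    have HJ' phi : J' phi <-> reduction phi by split=> [/RJ'|/HJ/JJ'].
    have [csub clsub] := subst_closed cs.
    apply: V2 => //; first exact: structure_subst_inference_from cs.1.
    have F1in : F1 \in assumptions (inference_from [:: F1] F2) by rewrite mem_head.
    apply: sF BC _; apply: (S1 J' C (s F1)) => //.
    * exact: (cs.1 _ F1in).2.
    * exact: cs.2.
    * exact: Vs.
Qed.

Lemma standard_reducibility n B G A :
  standard_consequence n B G A -> reducibility_consequence n B G A.
Proof.
case: G => [|F G] H.
  exists (Ax A None), reduction; split=> //.
  exact: (closed_valid_sat n A).2.
have G0 : ~~ nilp (F :: G) by [].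
have {}H : forall C, base_ext n B C ->
    (forall F', F' \in F :: G -> sat n F' C) -> sat n A C := H.
move: {F G}(F :: G) G0 H => G G0 H.
have aD := assumptions_inference_from G A.
exists (inference_from G A), reduction; split=> //.
- exact: structure_inference_from.
- by rewrite aD.
- apply/valid_open; first by rewrite /closed_tree aD.
  move=> s J C cs RJ JJ BC; rewrite aD => Vs.
  have HJ phi : J phi <-> reduction phi by split=> [/RJ|/JJ].
  have [_ clsub] := subst_closed cs.
  apply: (closed_valid_sat n A).2 => //.
    exact: structure_subst_inference_from cs.1.
  apply: H => // F FG; have FD : F \in assumptions (inference_from G A) by rewrite aD.
  apply: ((closed_valid_sat n F).1 J C (s F)) => //.
  + exact: (cs.1 _ FD).2.
  + exact: cs.2.
  + exact: Vs.
Qed.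

(** * Kripke models *)

(** Forcing at the world w, for the letters true at each world given by val and
    the accessibility relation le; [Bot] is forced nowhere. *)
Fixpoint forces (W : Type) (le : W -> W -> Prop) (val : W -> nat -> Prop)
    (w : W) (A : formula) : Prop :=
  match A with
  | Atom (Letter i) => val w i
  | Atom Bot => False
  | And A1 A2 => forces le val w A1 /\ forces le val w A2
  | Or A1 A2 => forces le val w A1 \/ forces le val w A2
  | Imp A1 A2 => forall v, le w v -> forces le val v A1 -> forces le val v A2
  end.

Section Kripke.

Variables (W : Type) (le : W -> W -> Prop) (val : W -> nat -> Prop).
Hypotheses (le_refl : forall w, le w w)
  (le_trans : forall u v w, le u v -> le v w -> le u w)
  (val_mono : forall v w i, le v w -> val v i -> val w i).

Lemma forces_mono v w A : le v w -> forces le val v A -> forces le val w A.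
Proof.
move=> vw; elim: A => [[i|]|A1 IH1 A2 IH2|A1 IH1 A2 IH2|A1 _ A2 _] //=.
- exact: val_mono.
- by case=> /IH1 H1 /IH2 H2.
- by case=> [/IH1|/IH2]; [left|right].
- by move=> H u wu; apply: H; apply: le_trans wu.
Qed.

Lemma IL_sound B G A : (forall R, B R -> exists a, R = explosion a) ->
  IL B G A -> forall w, (forall F, F \in G -> forces le val w F) ->
  forces le val w A.
Proof.
have ext w v F G' : le w v -> (forall H, H \in G' -> forces le val w H) ->
    forces le val v F -> forall H, H \in F :: G' -> forces le val v H.
  move=> wv Gw Fv H; rewrite inE => /orP [/eqP -> //|/Gw].
  exact: forces_mono.
move=> expB d; elim: d expB => {B G A}.
- by move=> B G A AG _ w; apply.
- by move=> B G A1 A2 _ IH1 _ IH2 eB w Gw; split; [apply: IH1|apply: IH2].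
- by move=> B G A1 A2 _ IH eB w /(IH eB) [].
- by move=> B G A1 A2 _ IH eB w /(IH eB) [].
- by move=> B G A1 A2 _ IH eB w Gw; left; apply: IH.
- by move=> B G A1 A2 _ IH eB w Gw; right; apply: IH.
- move=> B G A1 A2 A _ IH _ IH1 _ IH2 eB w Gw.
  by case: (IH eB w Gw) => H; [apply: IH1|apply: IH2] => //; apply: (ext w).
- by move=> B G A1 A2 _ IH eB w Gw v wv H; apply: IH => //; apply: (ext w).
- by move=> B G A1 A2 _ IH1 _ IH2 eB w Gw; apply: (IH1 eB w Gw) => //; apply: IH2.
- by move=> B G A _ IH eB w /(IH eB).
- move=> B G ps a BR _ IH eB w Gw; case: (eB _ BR) => b [eps _].
  have [] // := IH [::] Bot _ _ w Gw; first by rewrite eps; left.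
  by move=> R [/eB|].
Qed.

End Kripke.

(** * The counterexample *)

Definition explosion_base : base := fun R => exists a, R = explosion a.

Lemma explosion_base_le n : base_le n explosion_base.
Proof. by split=> [a|R [a ->]]; [|right]; exists a. Qed.

Definition imp_or (p q r : atom) : formula :=
  Imp (Atom p) (Or (Atom q) (Atom r)).

Definition or_imp (p q r : atom) : formula :=
  Or (Imp (Atom p) (Atom q)) (Imp (Atom p) (Atom r)).

(** The consequence holds on every base, not only on the explosion rules. *)
Lemma imp_or_standard n B p q r :
  standard_consequence n B [:: imp_or p q r] (or_imp p q r).
Proof.
move=> C [_ [expC levC]] /(_ _ (mem_head _ _)) /= H.
have extC : base_ext n C (add_rules C [:: Rule [::] p]).
  split=> [R CR|]; first by left.
  split=> [a|R [/levC //|[<-|//]]]; first by left.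
  by left.
have derp : derivable (add_rules C [:: Rule [::] p]) p.
  by exists (Ax (Atom p) None) => //; apply: der_axiom; right; left.
by case: (H _ extC derp) => der; [left|right] => E [CE _];
  apply: derivable_cut CE der.
Qed.

Lemma imp_or_not_IL :
  ~ IL explosion_base [:: imp_or (Letter 0) (Letter 1) (Letter 2)]
      (or_imp (Letter 0) (Letter 1) (Letter 2)).
Proof.
(* The root is [None]; [Some true] forces the letters 0 and 1, and [Some false]
   the letters 0 and 2. *)
pose le (v w : option bool) := v = None \/ v = w.
pose val (w : option bool) i :=
  match i with 0 => w <> None | 1 => w = Some true | _ => w = Some false end.
move=> d; have := @IL_sound _ le val _ _ _ _ _ _ _ d None.
case.
- by move=> w; right.
- by move=> u v w [->|->]; [left|].
- by move=> v w [|[|i]] [->|->].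
- by [].
- move=> F; rewrite inE => /eqP -> [[]|] _ /= w0; [by left|by right|by case: w0].
- by move=> /(_ (Some false) (or_introl erefl)) /=; case.
- by move=> /(_ (Some true) (or_introl erefl)) /=; case.
Qed.

Theorem proposition13 (n : nat) :
  ~ base_complete n (standard_consequence n) /\
  ~ base_complete n (reducibility_consequence n).
Proof.
split=> H; apply: imp_or_not_IL; apply: H (explosion_base_le n) _.
  exact: imp_or_standard.
exact/standard_reducibility/imp_or_standard.
Qed.
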